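(* Let $n\ge 1$ be given. Let $d\ge 0$ be the integer with $2^{d-1}<n\le 2^d$, and let $u_0,\dots,u_{d-1}\in S^1$ be any good collection of unit directions. Let $$A=\left\{a_0u_0+\dots+a_{d-1}u_{d-1}\ \middle|\ a_j\in\{0,1\},\ 0\le a_0+a_1 2+\dots+a_{d-1}2^{d-1}<n\right\}.$$ Then $A$ is an $n$-point set in the Euclidean plane with rationally independent unit direction set which determines exactly $T(n)$ unit distances, the maximum possible.
   Context: $S^1\subset\mathbb{R}^2$ is the unit circle and $\|\cdot\|$ is the Euclidean norm. A collection of distinct unit directions $u_1,\dots,u_\ell\in S^1$ is good if, whenever $(a_1,\dots,a_\ell)\in\mathbb{Z}^\ell$ satisfies $\|a_1u_1+\dots+a_\ell u_\ell\|=1$, exactly one of the $a_j$ is nonzero (necessarily equal to $\pm1$). The indexing may start at $0$ instead of $1$. For $d=0$ the collection is empty and $A=\{0\}$. For a finite set $A\subset\mathbb{R}^2$, the number of unit distances determined by $A$ is the number of unordered pairs $\{x,y\}\subset A$ with $\|x-y\|=1$. The unit direction set of $A$ is $$D_A=\{x-y \mid x,y\in A,\ \|x-y\|=1,\ \mathrm{Arg}(x-y)\in[0,\pi)\}\subset S^1,$$ where $\mathrm{Arg}$ is the principal argument. $A$ has rationally independent unit direction set if the (distinct) elements of $D_A$ are linearly independent over $\mathbb{Q}$ (the empty set counts as independent). $T(n)$ is the maximum number of unit distances determined by an $n$-point subset of $\mathbb{R}^2$ with rationally independent unit direction set. *)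

(* Defs.v *)
From HB Require Import structures.
From mathcomp Require Import all_boot all_order all_algebra finmap.
From mathcomp Require Import boolp reals trigo.

Set Implicit Arguments.
Unset Strict Implicit.
Unset Printing Implicit Defensive.

Import Order.TTheory GRing.Theory Num.Theory.
Local Open Scope fset_scope.
Local Open Scope ring_scope.

Notation plane R := 'rV[R]_2.

(* MathComp-Analysis puts the sup norm on matrices, hence a separate definition
   of the Euclidean norm. *)
Definition enorm (R : realType) (v : plane R) : R :=
  Num.sqrt (v 0 0 ^+ 2 + v 0 1 ^+ 2).

(* Principal argument, with values in ]-pi, pi] (see Arg_bounds and Arg_polar);
   the value at 0 is irrelevant. *)
Definition Arg (R : realType) (v : plane R) : R :=
  if 0 <= v 0 1 then acos (v 0 0 / enorm v) else - acos (v 0 0 / enorm v).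

(* An element of the set of edges is the unordered pair {x, y}. *)
Definition unit_distances (R : realType) (A : {fset plane R}) : nat :=
  #|` [fset [fset x; y] | x in A, y in A & enorm (x - y) == 1] |.

Definition unit_directions (R : realType) (A : {fset plane R}) :
    {fset plane R} :=
  [fset x - y | x in A, y in A &
     (enorm (x - y) == 1) && (0 <= Arg (x - y) < pi)].

Definition rationally_independent (R : realType) (D : {fset plane R}) : Prop :=
  forall c : plane R -> rat,
    \sum_(v <- D) ratr (c v) *: v = 0 -> forall v, v \in D -> c v = 0.

(* max_unit_distances R n is T(n).  The bound 'C(n, 2) only serves to make the
   maximum range over a finite set: see leq_max_unit_distances and
   max_unit_distances_attained. *)
Definition max_unit_distances (R : realType) (n : nat) : nat :=
  \max_(t < ('C(n, 2)).+1 |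
      `[< exists A : {fset plane R},
            [/\ #|` A| = n, rationally_independent (unit_directions A)
              & unit_distances A = t] >]) t.

Definition good (R : realType) (l : nat) (u : 'I_l -> plane R) : Prop :=
  [/\ injective u,
      forall j, enorm (u j) = 1
    & forall a : 'I_l -> int,
        enorm (\sum_(j < l) (a j)%:~R *: u j) = 1 -> exists! j, a j != 0].

Definition binary_sum (R : realType) (d : nat) (u : 'I_d -> plane R)
    (a : {ffun 'I_d -> bool}) : plane R :=
  \sum_(j < d) (a j)%:R *: u j.

Definition binary_set (R : realType) (n d : nat) (u : 'I_d -> plane R) :
    {fset plane R} :=
  [fset binary_sum u a | a : {ffun 'I_d -> bool} &
     (\sum_(j < d) a j * 2 ^ j < n)%N].

Section Facts.
Variable R : realType.
Implicit Types (A : {fset plane R}) (v : plane R).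

Lemma enorm0 : enorm (0 : plane R) = 0.
Proof. by rewrite /enorm !mxE expr0n /= addr0 sqrtr0. Qed.

Lemma sqr_enorm v : enorm v ^+ 2 = v 0 0 ^+ 2 + v 0 1 ^+ 2.
Proof. by rewrite sqr_sqrtr// addr_ge0// sqr_ge0. Qed.

Lemma enorm_eq0 v : (enorm v == 0) = (v == 0).
Proof.
apply/eqP/eqP => [v0|->]; last exact: enorm0.
have /eqP := sqr_enorm v; rewrite v0 expr0n /= eq_sym.
rewrite paddr_eq0 ?sqr_ge0// !sqrf_eq0 => /andP[/eqP x0 /eqP y0].
apply/rowP => i; rewrite mxE; case: (unliftP 0 i) => [j|] ->; last by [].
by rewrite ord1 -y0; congr (v _ _); apply/val_inj.
Qed.

Lemma enorm_gt0 v : v != 0 -> 0 < enorm v.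
Proof. by move=> v0; rewrite lt_def enorm_eq0 v0 sqrtr_ge0. Qed.

Lemma ratio_sqr v : v != 0 ->
  (v 0 0 / enorm v) ^+ 2 + (v 0 1 / enorm v) ^+ 2 = 1.
Proof.
move=> v0; rewrite !expr_div_n -mulrDl -sqr_enorm divff//.
by rewrite expf_eq0 /= enorm_eq0.
Qed.

Lemma ratio_itv v : v != 0 -> -1 <= v 0 0 / enorm v <= 1.
Proof.
move=> v0; rewrite -ler_norml -[leRHS]normr1 -ler_sqr ?nnegrE//.
rewrite real_normK ?num_real//.
by rewrite normr1 expr1n -(ratio_sqr v0) lerDl sqr_ge0.
Qed.

Lemma Arg_bounds v : v != 0 -> - pi < Arg v <= pi.
Proof.
move=> v0; have rI := ratio_itv v0; rewrite /Arg; case: ifPn => y0.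
  by rewrite acos_lepi// andbT (lt_le_trans _ (acos_ge0 rI))// oppr_lt0 pi_gt0.
rewrite (@le_trans _ _ 0) ?oppr_le0 ?acos_ge0 ?pi_ge0// andbT ltrN2.
apply: acos_ltpi; case/andP: rI => r1 ->; rewrite andbT lt_def r1 andbT.
apply: contraNneq y0 => r; have := ratio_sqr v0; rewrite r sqrrN expr1n.
move/eqP; rewrite -subr_eq0 addrC addKr sqrf_eq0 mulf_eq0 invr_eq0 enorm_eq0.
by rewrite (negPf v0) orbF => /eqP ->.
Qed.

Lemma Arg_polar v : v != 0 ->
  v 0 0 = enorm v * cos (Arg v) /\ v 0 1 = enorm v * sin (Arg v).
Proof.
move=> v0; have rI := ratio_itv v0; have e0 := enorm_gt0 v0.
have sE : sin (acos (v 0 0 / enorm v)) = `|v 0 1| / enorm v.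
  rewrite sin_acos// -(ratio_sqr v0) addrC addKr sqrtr_sqr normrM normfV.
  by rewrite (gtr0_norm e0).
have kE x : enorm v * (x / enorm v) = x.
  by rewrite mulrCA divff ?mulr1// gt_eqF.
rewrite /Arg; case: ifPn => y0.
  by rewrite acosK// sE ger0_norm// !kE.
rewrite cosN sinN acosK// sE ltr0_norm ?ltNge// mulNr opprK !kE.
by [].
Qed.

Lemma unit_distances_bound A : (unit_distances A <= 'C(#|` A|, 2))%N.
Proof.
rewrite /unit_distances (cardfE A) -card_draws.
set D := [set _ | _].
pose g (Y : {set A}) : {fset plane R} := [fsetval x in Y].
have sub : [fset [fset x; y] | x in A, y in A & enorm (x - y) == 1] `<=`
    [fset g Y | Y in D].
  apply/fsubsetP => e /imfset2P[/= x xA [y]]; rewrite !inE => /andP[yA xy] ->.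
  have sA : [fset x; y] `<=` A by rewrite fsubUset !fsub1set xA.
  apply/imfsetP; exists (fsub A [fset x; y]); last by rewrite /g fsubK.
  rewrite !inE/= card_fsub// cardfs2; case: (x =P y) xy => // ->.
  by rewrite subrr enorm0 eq_sym oner_eq0.
apply: leq_trans (fsubset_leq_card sub) _.
by rewrite (leq_trans (leq_imfset_card _ _ _))//= -cardE.
Qed.

Lemma leq_max_unit_distances A : rationally_independent (unit_directions A) ->
  (unit_distances A <= max_unit_distances R #|` A|)%N.
Proof.
move=> iA; have tP : (unit_distances A < 'C(#|` A|, 2).+1)%N.
  by rewrite ltnS unit_distances_bound.
rewrite -[leqLHS]/(val (Ordinal tP)); apply: leq_bigmax_cond.
by apply/asboolP; exists A.
Qed.

Lemma enorm_row (x : R) : enorm (\row_j (if j == 0 then x else 0)) = `|x|.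
Proof. by rewrite /enorm !mxE/= expr0n addr0 sqrtr_sqr. Qed.

Lemma max_unit_distances_attained n : exists A,
  [/\ #|` A| = n, rationally_independent (unit_directions A)
    & unit_distances A = max_unit_distances R n].
Proof.
pose p (i : 'I_n) : plane R := \row_j (if j == 0 then (i.*2)%:R else 0).
pose A := [fset p i | i : 'I_n].
have pB i k : p i - p k = \row_j (if j == 0 then (i.*2)%:R - (k.*2)%:R else 0).
  by apply/rowP => j; rewrite !mxE; case: ifP; rewrite ?subr0.
have far x y : x \in A -> y \in A -> enorm (x - y) == 1 = false.
  move=> /imfsetP[/= i _ ->] /imfsetP[/= k _ ->].
  rewrite pB enorm_row; apply/negP.
  wlog ki : i k / (k <= i)%N.
    by case: (leqP k i) => [|/ltnW] ki H; [exact: H|rewrite distrC; exact: H].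
  rewrite -natrB ?leq_double// normr_nat -[1]/(1%:R) eqr_nat -doubleB.
  by move=> /eqP/(congr1 odd); rewrite odd_double.
have pI : injective p.
  move=> i k /rowP/(_ 0); rewrite !mxE/= => /eqP; rewrite eqr_nat.
  by rewrite -!muln2 eqn_pmul2r// => /eqP/val_inj.
have A0 : exists A, [/\ #|` A| = n, rationally_independent (unit_directions A)
    & unit_distances A = 0%N].
  exists A; split.
  - by rewrite card_imfset//= -cardE card_ord.
  - move=> c _ v /imfset2P[/= x xA [y]]; rewrite !inE => /andP[yA].
    by rewrite far.
  - apply/eqP; rewrite cardfs_eq0; apply/eqP/fsetP => e; rewrite in_fset0.
    apply/negP => /imfset2P[/= x xA [y]]; rewrite !inE => /andP[yA].
    by rewrite far.
rewrite /max_unit_distances.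
rewrite (bigop.bigmax_eq_arg ord0) /=; last exact/asboolP.
by case: arg_maxnP => [|t /asboolP[B BP] _]; [exact/asboolP|exists B].
Qed.

End Facts.

(* Main.v *)
Require Import Defs.
From HB Require Import structures.
From mathcomp Require Import all_boot all_order all_algebra finmap.
From mathcomp Require Import boolp reals trigo.
From mathcomp Require Import zify ring lra.

Set Implicit Arguments.
Unset Strict Implicit.
Unset Printing Implicit Defensive.

Import Order.TTheory GRing.Theory Num.Theory.
Local Open Scope fset_scope.
Local Open Scope ring_scope.

(** Write s(i) for the number of binary digits 1 of i and e(n) for the sum of
s(i) over i < n.  Both the number of unit distances of A and the maximum are
equal to e(n).

The arithmetic behind this is e(a) + e(b) + min(a, b) <= e(a + b)
([popsum_superadd]), proved by halving a and b.

Upper bound ([arcs_le_popsum]).  Let D be rationally independent, and call a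
pair (x, y) of points of a finite set A with x - y in D an arc; for D the unit
directions of A, arcs correspond to unit distances ([unit_distances_arcs]).
There are at most e(#A) arcs, by induction on #A.  Given an arc (y + v, y), let
A1 be the set of the points z of A such that z - y is a rational combination of
D in which v has a coefficient at most 0, and let A2 be the rest of A.  Then y
is in A1 and, by independence, y + v is in A2.  Subtracting an element of D
does not leave A1, nor does adding one other than v, so every arc between A1
and A2 is of the form (t + v, t) with t in A1 and t + v in A2.  There are at
most min(#A1, #A2) of them, and the arithmetic inequality concludes.

Lower bound ([unit_distances_binary_set]).  A good collection is rationally
independent ([good_ratr_independent]): if m is a nonzero integral relation with
m_k <> 0, adding 2m to the trivial combination u_k gives combinations of norm 1
whose k-th coefficient is odd, so that all the other coefficients of m vanish,
and m_k u_k = 0 is absurd.  Hence the points of A have unique binary codes, and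
A has n of them.  A unit vector between two points of A is some u_j up to sign,
which makes the unit directions of A independent.  Finally, clearing a digit 1
of the code of a point yields a point of A at distance 1, and there are e(n)
ways to do so. *)

(** * Sums of binary digits *)

(** The number of binary digits 1 of n; the digits of rank at least n are 0,
since n < 2 ^ n. *)
Definition popcount (n : nat) : nat := (\sum_(j < n) odd (n %/ 2 ^ j))%N.

(** The total number of digits 1 in the numbers less than n. *)
Definition popsum (n : nat) : nat := (\sum_(i < n) popcount i)%N.

Lemma popcount_widen (n k : nat) : (n <= k)%N ->
  (\sum_(j < k) odd (n %/ 2 ^ j) = popcount n)%N.
Proof.
move=> nk; rewrite /popcount.
rewrite -(big_mkord xpredT (fun j => odd (n %/ 2 ^ j) : nat)).
rewrite (big_cat_nat (n := n))//= big_mkord.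
rewrite [X in (_ + X)%N]big_nat_cond [X in (_ + X)%N]big1 ?addn0//.
move=> j /andP[/andP[nj _] _].
by rewrite divn_small// (leq_ltn_trans nj)// ltn_expl.
Qed.

Lemma popcount_bit (b : bool) (m : nat) :
  popcount (b + m.*2) = (b + popcount m)%N.
Proof.
have le_k : (b + m.*2 <= m.*2.+1)%N by case: b; lia.
rewrite -(popcount_widen le_k) big_ord_recl/= divn1 oddD odd_double addbF oddb.
have m2 : (m <= m.*2)%N by lia.
rewrite -(popcount_widen m2); congr addn; apply: eq_bigr => j _.
have half : ((b + m.*2) %/ 2 = m)%N by case: b {le_k}; lia.
by rewrite /bump/= add1n expnS divnMA half.
Qed.

Lemma popsumS n : popsum n.+1 = (popsum n + popcount n)%N.
Proof. exact: big_ord_recr. Qed.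

Lemma popsum_double m : popsum m.*2 = (popsum m + popsum m + m)%N.
Proof.
elim: m => [|m IHm]; first by rewrite /popsum !big_ord0.
have := popcount_bit true m; have := popcount_bit false m.
rewrite doubleS !popsumS IHm /= add0n add1n; lia.
Qed.

Lemma popsum_doubleS m : popsum m.*2.+1 = (popsum m + popsum m.+1 + m)%N.
Proof.
have := popcount_bit false m.
rewrite !popsumS popsum_double /= !add0n; lia.
Qed.

(** Splitting a and b into halves and pairing a half of a with a half of b
reduces a + b to its two halves. *)
Lemma popsum_superadd (a b : nat) :
  (popsum a + popsum b + minn a b <= popsum (a + b))%N.
Proof.
have [k] := ubnP (a + b); elim: k a b => // k IHk a b.
wlog ab : a b / (a <= b)%N => [H|].
  case/orP: (leq_total a b) => ab kP; first exact: H.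
  by rewrite [(popsum a + _)%N]addnC minnC [(a + b)%N]addnC H// addnC.
case: a ab => [_ _|a' ab]; first by rewrite min0n addn0 {1}/popsum big_ord0.
move: (a'.+1) ab (ltn0Sn a') => a {a'} ab a_gt0 kP; rewrite (minn_idPl ab).
have aE := odd_double_half a; have bE := odd_double_half b.
move: (odd a) (odd b) a./2 b./2 aE bE => pa pb a0 b0 aE bE; subst a b.
case: pa pb ab kP a_gt0 => -[] /=; rewrite !(add1n, add0n) => ab kP a_gt0.
(* When both are odd, unequal halves are paired, which leaves a slack of 1
   that absorbs the case a = b. *)
- have -> : (a0.*2.+1 + b0.*2.+1 = (a0 + b0).+1.*2)%N by lia.
  rewrite popsum_double !popsum_doubleS.
  have := IHk a0 b0.+1 ltac:(lia); have := IHk a0.+1 b0 ltac:(lia).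
  rewrite addSn addnS; lia.
- have -> : (a0.*2.+1 + b0.*2 = (a0 + b0).*2.+1)%N by lia.
  rewrite popsum_double !popsum_doubleS.
  have := IHk a0 b0 ltac:(lia); have := IHk a0.+1 b0 ltac:(lia).
  rewrite addSn; lia.
- have -> : (a0.*2 + b0.*2.+1 = (a0 + b0).*2.+1)%N by lia.
  rewrite popsum_double !popsum_doubleS.
  have := IHk a0 b0 ltac:(lia); have := IHk a0 b0.+1 ltac:(lia).
  rewrite addnS; lia.
- by rewrite -doubleD !popsum_double; have := IHk a0 b0 ltac:(lia); lia.
Qed.

Lemma popcount_binary (d : nat) (f : 'I_d -> bool) :
  popcount (\sum_(j < d) f j * 2 ^ j) = (\sum_(j < d) f j)%N.
Proof.
elim: d f => [|d IHd] f; first by rewrite !big_ord0 /popcount big_ord0.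
rewrite !big_ord_recl /= muln1 -IHd -popcount_bit -muln2 big_distrl /=.
congr (popcount (_ + _)); apply: eq_bigr => j _.
by rewrite /bump/= add1n expnSr mulnA.
Qed.

Lemma binary_ltn (d : nat) (f : 'I_d -> bool) :
  (\sum_(j < d) f j * 2 ^ j < 2 ^ d)%N.
Proof.
elim: d f => [|d IHd] f; first by rewrite big_ord0.
rewrite big_ord_recr /= expnS mul2n -addnn -addSn leq_add//.
by case: (f _); rewrite ?mul1n.
Qed.

Lemma binary_inj (d : nat) :
  injective (fun a : {ffun 'I_d -> bool} => \sum_(j < d) a j * 2 ^ j)%N.
Proof.
move=> a b ab; apply/ffunP => j; move: (a : _ -> _) (b : _ -> _) ab j.
elim: d {a b} => [|d IHd] f g; first by move=> _ [].
have split2 (h : 'I_d.+1 -> bool) : (\sum_(j < d.+1) h j * 2 ^ j =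
    h ord0 + (\sum_(j < d) h (lift ord0 j) * 2 ^ j).*2)%N.
  rewrite big_ord_recl muln1 -muln2 big_distrl /=; congr addn.
  by apply: eq_bigr => j _; rewrite /bump/= add1n expnSr mulnA.
rewrite !split2 => fg j; have [i ->|->] := unliftP ord0 j; last first.
  by move/(congr1 odd): fg; rewrite !oddD !odd_double !addbF !oddb.
apply: (IHd (f \o lift ord0) (g \o lift ord0)) => /=.
by move/(congr1 half): fg; rewrite !half_bit_double.
Qed.

Lemma sum_binary (n d : nat) (F : nat -> nat) : (n <= 2 ^ d)%N ->
  (\sum_(a : {ffun 'I_d -> bool} | \sum_(j < d) a j * 2 ^ j < n)
     F (\sum_(j < d) a j * 2 ^ j) = \sum_(i < n) F i)%N.
Proof.
move=> n_le.
pose h (a : {ffun 'I_d -> bool}) : 'I_(2 ^ d) := Ordinal (binary_ltn a).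
have h_bij : bijective h.
  apply: inj_card_bij => [a b /(congr1 val)|]; first exact: binary_inj.
  by rewrite card_ord card_ffun card_bool card_ord.
rewrite (big_ord_widen _ F n_le) (reindex h); first by [].
exact: onW_bij.
Qed.

(** * Unit distances as differences in a set of directions *)

Lemma sum_bool_count (T : Type) (P : pred T) (s : seq T) :
  (\sum_(x <- s) P x)%N = count P s.
Proof. by rewrite -sum1_count [RHS]big_mkcond. Qed.

Section Directions.
Variable R : realType.
Implicit Types (A B D : {fset plane R}) (v x y z t : plane R).

Lemma enormN v : enorm (- v) = enorm v.
Proof. by rewrite /enorm !mxE !sqrrN. Qed.

(** Arguments in [0, pi) describe the open upper half plane together with the
positive half of the first axis. *)
Lemma upper_ArgE v : enorm v = 1 ->
  (0 <= Arg v < pi) = (0 < v 0 1) || (v 0 1 == 0) && (0 < v 0 0).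
Proof.
move=> v1; have := sqr_enorm v; rewrite /Arg v1 divr1 expr1n => /esym circle.
case: (ltrgtP (v 0 1) 0) => y0 /=.
- have x1 : -1 <= v 0 0 < 1 by nra.
  by have := acos_gt0 x1; rewrite -oppr_lt0 leNgt => ->.
- have x1 : -1 < v 0 0 <= 1 by nra.
  by rewrite acos_ltpi// acos_ge0//; lra.
- have : (v 0 0 - 1) * (v 0 0 + 1) = 0 by move: circle; rewrite y0; lra.
  move/eqP; rewrite mulf_eq0 => /orP[] /eqP x1.
    have -> : v 0 0 = 1 by lra.
    by rewrite acos1 lexx pi_gt0 ltr01.
  have -> : v 0 0 = -1 by lra.
  by rewrite acosN1 ltxx andbF oppr_gt0 ltr10.
Qed.

Lemma upper_ArgN v : enorm v = 1 ->
  (0 <= Arg (- v) < pi) = ~~ (0 <= Arg v < pi).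
Proof.
move=> v1; rewrite !upper_ArgE ?enormN// !mxE oppr_eq0 !oppr_gt0.
case: (ltrgtP (v 0 1) 0) => //= y0; have := sqr_enorm v.
rewrite v1 y0; case: (ltrgtP (v 0 0) 0) => // ->.
by move/eqP; rewrite !expr0n expr1n addr0 oner_eq0.
Qed.

Lemma unit_directionsP A x y : x \in A -> y \in A ->
  (x - y \in unit_directions A) =
    (enorm (x - y) == 1) && (0 <= Arg (x - y) < pi).
Proof.
move=> xA yA; apply/idP/idP.
  by case/imfset2P => /= x' _ [y']; rewrite !inE => /andP[_ P] ->.
by move=> P; apply/imfset2P; exists x => //; exists y; rewrite // !inE yA.
Qed.

(** The number of pairs (x, y) in A x B whose difference is in D. *)
Definition arcs D A B : nat :=
  (\sum_(x <- A) \sum_(y <- B) ((x - y)%R \in D))%N.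

(** If D contains exactly one of v and - v for each unit vector v between two
points of A, then it orients each unit distance in exactly one way. *)
Lemma unit_distances_arcs D A :
    {in A &, forall x y, x - y \in D -> enorm (x - y) = 1} ->
    {in A &, forall x y, enorm (x - y) = 1 ->
      (y - x \in D) = ~~ (x - y \in D)} ->
  unit_distances A = arcs D A A.
Proof.
move=> D1 DN.
pose S := [fset p | p in A `*` A & p.1 - p.2 \in D].
have SP (p : plane R * plane R) :
    (p \in S) = [&& p.1 \in A, p.2 \in A & p.1 - p.2 \in D].
  by rewrite /S !inE andbA.
have -> : unit_distances A = #|` [fset [fset p.1; p.2] | p in S]|.
  rewrite /unit_distances; congr (size (enum_fset _)); apply/fsetP => e.
  apply/imfset2P/imfsetP => /=.
    move=> [x xA [y]]; rewrite !inE => /andP[yA /eqP xy1] ->.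
    have [xyD|xyD] := boolP (x - y \in D).
      by exists (x, y); rewrite //= SP /= xA yA.
    exists (y, x); last by rewrite fsetUC.
    by rewrite SP /= xA yA (DN _ _ xA yA xy1).
  move=> [[x y]]; rewrite SP /= => /and3P[xA yA xyD] ->.
  by exists x => //; exists y; rewrite // !inE yA D1/=.
rewrite card_in_imfset /=; last first.
  move=> [x y] [x' y']; rewrite !SP /= => /and3P[xA yA xyD].
  move=> /and3P[x'A y'A xyD'] /fsetP e.
  have xy1 := D1 _ _ xA yA xyD.
  have xNy : x != y.
    by apply: contra_eq_neq xy1 => ->; rewrite subrr enorm0 eq_sym oner_eq0.
  have /orP : (x == x') || (x == y') by rewrite -in_fset2 -e fset21.
  have /orP : (y == x') || (y == y') by rewrite -in_fset2 -e fset22.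
  case=> /eqP yE; case=> /eqP xE; first by rewrite xE yE eqxx in xNy.
  - by have := DN _ _ xA yA xy1; rewrite xyD {1}xE {1}yE xyD'.
  - by rewrite xE yE.
  - by rewrite xE yE eqxx in xNy.
have -> : arcs D A A =
    (\sum_(p <- [seq (x, y) | x <- A, y <- A]) ((p.1 - p.2)%R \in D))%N.
  by rewrite big_allpairs.
rewrite sum_bool_count -size_filter.
apply/perm_size/uniq_perm; first exact: fset_uniq.
  by rewrite filter_uniq// allpairs_uniq ?fset_uniq// => -[? ?] [? ?].
move=> [x y]; rewrite SP mem_filter andbA andbC; congr andb.
apply/andP/allpairsP => [[xA yA]|[[x' y'] [/= x'A y'A [-> ->]]]//].
by exists (x, y).
Qed.

(** * The upper bound *)

Lemma sum_eq_le1 (s : seq (plane R)) x :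
  uniq s -> (\sum_(y <- s) (y == x) <= 1)%N.
Proof.
by move=> s_uniq; rewrite sum_bool_count count_uniq_mem ?leq_b1.
Qed.

Lemma sum_delta D v : v \in D ->
  \sum_(w <- D) ratr (w == v)%:R *: w = v.
Proof.
move=> vD; rewrite (bigD1_seq v) ?fset_uniq//= eqxx rmorph1 scale1r.
by rewrite big1 ?addr0// => w /negPf ->; rewrite rmorph0 scale0r.
Qed.

(** z - y is a rational combination of D where the coefficient of v is at most
0.  The combination is not required to be unique. *)
Definition below D v y z : Prop := exists c : plane R -> rat,
  c v <= 0 /\ z - y = \sum_(w <- D) ratr (c w) *: w.

Lemma below_refl D v y : below D v y y.
Proof.
exists (fun=> 0); split=> //; rewrite subrr big1// => w _.
by rewrite rmorph0 scale0r.
Qed.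

Lemma below_add D v y z w (e : rat) : w \in D -> (w = v -> e <= 0) ->
  below D v y z -> below D v y (z + ratr e *: w).
Proof.
move=> wD e0 [c [cv cE]]; exists (fun x => c x + e * (x == w)%:R); split.
  by case: (v =P w) => [/esym/e0|_]; rewrite ?mulr1 ?mulr0 ?addr0//; lra.
rewrite addrAC cE -[X in _ + _ *: X](sum_delta wD) scaler_sumr -big_split.
by apply: eq_bigr => x _; rewrite rmorphD rmorphM scalerDl scalerA.
Qed.

(** By independence, the coefficient of v in v is 1. *)
Lemma not_below_step D v y : rationally_independent D -> v \in D ->
  ~ below D v y (y + v).
Proof.
move=> D_indep vD [c [cv]]; rewrite addrC addKr => cE.
suff /D_indep/(_ _ vD) : \sum_(w <- D) ratr (c w - (w == v)%:R) *: w = 0.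
  by rewrite eqxx mulr1n; lra.
rewrite -[RHS](subrr v) [X in _ = X - _]cE.
rewrite -[X in _ = _ - X](sum_delta vD) -sumrB.
by apply: eq_bigr => w _; rewrite rmorphB scalerBl.
Qed.

Lemma arcs_fsetIDl (P : pred (plane R)) D A B :
  arcs D A B =
    (arcs D [fset x in A | P x] B + arcs D [fset x in A | ~~ P x] B)%N.
Proof. exact: big_fsetID. Qed.

Lemma arcs_fsetIDr (P : pred (plane R)) D A B :
  arcs D A B =
    (arcs D A [fset x in B | P x] + arcs D A [fset x in B | ~~ P x])%N.
Proof.
by rewrite /arcs -big_split; apply: eq_bigr => x _; exact: big_fsetID.
Qed.

Lemma arcs_eq0 D A B :
  {in A & B, forall x y, x - y \notin D} -> arcs D A B = 0%N.
Proof.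
move=> AB; rewrite /arcs big1_seq// => x /= xA; rewrite big1_seq// => y /= yB.
by rewrite (negPf (AB _ _ xA yB)).
Qed.

(** Translation by v is injective, so arcs in a single direction v form a
matching between A and B. *)
Lemma arcs_parallel D A B v :
    {in A & B, forall x y, x - y \in D -> x - y = v} ->
  (arcs D A B <= minn #|` A| #|` B|)%N.
Proof.
move=> ABv.
have le x y : x \in A -> y \in B -> (((x - y)%R \in D) <= (y == (x - v)%R))%N.
  move=> xA yB; case: (boolP (x - y \in D)) => // /(ABv _ _ xA yB) <-.
  by rewrite opprB addrC subrK eqxx.
rewrite leq_min; apply/andP; split.
  (* Each x in A is the head of at most one arc, from x - v. *)
  rewrite card_fset_sum1 /arcs big_seq [leqRHS]big_seq; apply: leq_sum => x xA.
  apply: leq_trans (sum_eq_le1 (x - v) (fset_uniq B)).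
  by rewrite big_seq [leqRHS]big_seq; apply: leq_sum => y yB; exact: le.
rewrite card_fset_sum1 /arcs exchange_big big_seq [leqRHS]big_seq.
apply: leq_sum => y yB; apply: leq_trans (sum_eq_le1 (y + v) (fset_uniq A)).
rewrite big_seq [leqRHS]big_seq; apply: leq_sum => x xA.
by rewrite (leq_trans (le _ _ xA yB))// eq_sym subr_eq.
Qed.

Lemma arcs_le_popsum D A : rationally_independent D ->
  (arcs D A A <= popsum #|` A|)%N.
Proof.
move=> D_indep; have [k] := ubnP #|` A|; elim: k A => // k IHk A A_le.
have [[y [v [yA yvA vD]]]|no_arc] :=
  pselect (exists y v, [/\ y \in A, y + v \in A & v \in D]); last first.
  rewrite arcs_eq0// => x y xA yA; apply/negP => xyD; apply: no_arc.
  by exists y, (x - y); rewrite addrC subrK.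
pose P z := `[< below D v y z >].
set A1 := [fset z in A | P z]; set A2 := [fset z in A | ~~ P z].
have cardA : #|` A| = (#|` A1| + #|` A2|)%N.
  by rewrite !card_fset_sum1 (big_fsetID _ P).
have A1_gt0 : (0 < #|` A1|)%N.
  rewrite cardfs_gt0; apply/fset0Pn; exists y; rewrite !inE yA.
  by apply/asboolP/below_refl.
have A2_gt0 : (0 < #|` A2|)%N.
  rewrite cardfs_gt0; apply/fset0Pn; exists (y + v); rewrite !inE yvA.
  by apply/asboolP/not_below_step.
have A12 : arcs D A1 A2 = 0%N.
  apply: arcs_eq0 => z t; rewrite !inE.
  move=> /andP[_ /asboolP zP] /andP[_ /asboolP tP]; apply/negP => ztD; apply: tP.
  have := below_add (e := -1) ztD _ zP.
  rewrite rmorphN1 scaleN1r subKr; apply.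
  by rewrite oppr_le0 ler01.
have A21 : (arcs D A2 A1 <= minn #|` A1| #|` A2|)%N.
  rewrite minnC; apply: (@arcs_parallel _ _ _ v) => z t.
  rewrite !inE => /andP[_ /asboolP zP] /andP[_ /asboolP tP] ztD.
  apply: contrapT => ztv; apply: zP; have := below_add (e := 1) ztD _ tP.
  by rewrite rmorph1 scale1r [t + _]addrC subrK; apply.
rewrite (arcs_fsetIDl P) !(arcs_fsetIDr P _ _ A) -/A1 -/A2 A12 cardA.
have := IHk A1 ltac:(lia); have := IHk A2 ltac:(lia).
have := popsum_superadd #|` A1| #|` A2|; lia.
Qed.

End Directions.

Lemma unit_distances_le_popsum (R : realType) (A : {fset plane R}) :
  rationally_independent (unit_directions A) ->
  (unit_distances A <= popsum #|` A|)%N.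
Proof.
move=> D_indep; rewrite (@unit_distances_arcs _ (unit_directions A)).
- exact: arcs_le_popsum.
- by move=> x y xA yA; rewrite unit_directionsP// => /andP[/eqP].
- move=> x y xA yA xy1; rewrite !unit_directionsP// -opprB enormN xy1 eqxx.
  exact: upper_ArgN.
Qed.

(** * Good collections *)

Section GoodDirections.
Variables (R : realType) (d : nat) (u : 'I_d -> plane R).
Hypothesis u_good : good u.
Implicit Types (a b : {ffun 'I_d -> bool}) (i j k : 'I_d).

Lemma sum_delta_ord k : \sum_(j < d) (j == k)%:R%:~R *: u j = u k.
Proof.
rewrite (bigD1 k)//= eqxx scale1r big1 ?addr0// => j /negPf ->.
by rewrite scale0r.
Qed.

(** Adding twice the relation m to u k keeps the norm equal to 1 and the k-th
coefficient odd, hence nonzero; so no other coefficient of m can be nonzero. *)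
Lemma good_intr_independent (m : 'I_d -> int) :
  \sum_(j < d) (m j)%:~R *: u j = 0 -> forall k, m k = 0.
Proof.
case: u_good => _ u1 u_int m0 k; apply/eqP; apply: contraT => mk.
pose b j : int := (j == k)%:R + 2 * m j.
have /(congr1 (@enorm R)) : \sum_(j < d) (b j)%:~R *: u j = u k.
  under eq_bigr do rewrite rmorphD rmorphM scalerDl -scalerA.
  by rewrite big_split /= -scaler_sumr m0 scaler0 addr0 sum_delta_ord.
rewrite u1 => /u_int[i [_ i_uniq]].
have bk : b k != 0 by rewrite /b eqxx; lia.
have m_eq0 j : j != k -> m j = 0.
  move=> jk; have [bj|/i_uniq jE] := eqVneq (b j) 0.
    by move: bj; rewrite /b (negPf jk); lia.
  by rewrite -jE (i_uniq k bk) eqxx in jk.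
move: m0; rewrite (bigD1 k)//= big1 ?addr0; last first.
  by move=> j /m_eq0 ->; rewrite scale0r.
move/eqP; rewrite scaler_eq0 intr_eq0 (negPf mk) /= => /eqP uk.
by have := u1 k; rewrite uk enorm0 => /esym/eqP; rewrite oner_eq0.
Qed.

Lemma good_ratr_independent (q : 'I_d -> rat) :
  \sum_(j < d) ratr (q j) *: u j = 0 -> forall k, q k = 0.
Proof.
move=> q0 k; (* N is a common denominator of q, and m = N q. *)
pose N := \prod_(j < d) denq (q j).
pose m j := numq (q j) * \prod_(i < d | i != j) denq (q i).
have mE j : (m j)%:~R = N%:~R * q j :> rat.
  rewrite /N (bigD1 j)//= -/(m j) /m !rmorphM /= numqE; ring.
have N0 : N != 0 by apply/prodf_neq0 => j _; rewrite denq_neq0.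
have /good_intr_independent/(_ k) mk : \sum_(j < d) (m j)%:~R *: u j = 0.
  rewrite -[RHS](scaler0 _ N%:~R) -[in RHS]q0 scaler_sumr.
  apply: eq_bigr => j _.
  by rewrite scalerA -(ratr_int R (m j)) mE rmorphM /= ratr_int.
have /esym/eqP := mE k; rewrite mk mulf_eq0 intr_eq0 (negPf N0) /=.
by move/eqP.
Qed.

Lemma good_neq_opp i j : u i <> - u j.
Proof.
move=> ij; have /(_ i) : forall k, (k == i)%:R + (k == j)%:R = 0 :> int.
  apply: good_intr_independent.
  under eq_bigr do rewrite rmorphD scalerDl.
  by rewrite big_split /= !sum_delta_ord ij addNr.
by rewrite eqxx; case: (i == j).
Qed.

Lemma binary_sumB a b : binary_sum u a - binary_sum u b =
  \sum_(j < d) ((a j)%:R - (b j)%:R : int)%:~R *: u j.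
Proof.
rewrite /binary_sum -sumrB; apply: eq_bigr => j _.
by rewrite rmorphB scalerBl !rmorph_nat.
Qed.

Lemma binary_sum_inj : injective (binary_sum u).
Proof.
move=> a b /eqP; rewrite -subr_eq0 binary_sumB => /eqP.
move=> /good_intr_independent ab; apply/ffunP => j.
by have := ab j; case: (a j) (b j) => -[].
Qed.

(** The coefficients of a difference are in {-1, 0, 1}, and exactly one of them
is nonzero. *)
Lemma binary_sum_unit_diff a b : enorm (binary_sum u a - binary_sum u b) = 1 ->
  exists j, binary_sum u a - binary_sum u b = u j \/
    binary_sum u a - binary_sum u b = - u j.
Proof.
case: u_good => _ _ u_int; rewrite binary_sumB => /u_int[j [ab_j j_uniq]].
exists j; rewrite (bigD1 j)//= big1 ?addr0; last first.
  move=> i ij; have [->|/j_uniq ji] := eqVneq ((a i)%:R - (b i)%:R : int) 0.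
    by rewrite scale0r.
  by rewrite ji eqxx in ij.
case: (a j) (b j) ab_j => -[] //= _; [left|right].
  by rewrite subr0 scale1r.
by rewrite sub0r scaleN1r.
Qed.

(** A set made of vectors of the form u j or - u j, never containing both v and
- v, inherits the independence of u. *)
Lemma signed_independent (D : {fset plane R}) :
    {in D, forall v, exists j, v = u j \/ v = - u j} ->
    {in D, forall v, - v \notin D} ->
  rationally_independent D.
Proof.
move=> DP DN c c0.
(* q collects the coefficients of c along each u j; at most one of u j and
   - u j is in D, so that q j is, up to sign, c of that vector, or 0. *)
pose q j : rat := \sum_(v <- D) c v * ((v == u j)%:R - (v == - u j)%:R).
have inner v : v \in D ->
    \sum_(j < d) ((v == u j)%:R - (v == - u j)%:R : int)%:~R *: u j = v.
  have inj := let: And3 u_inj _ _ := u_good in u_inj.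
  move=> /DP[k [] ->].
    rewrite -[RHS]sum_delta_ord; apply: eq_bigr => j _.
    rewrite (inj_eq inj) eq_sym (_ : (u k == - u j) = false) ?subr0//.
    exact/eqP/good_neq_opp.
  rewrite -[RHS](congr1 -%R (sum_delta_ord k)) -sumrN; apply: eq_bigr => j _.
  rewrite eqr_opp (inj_eq inj) [k == j]eq_sym -scaleNr -rmorphN.
  rewrite eqr_oppLR (_ : (u k == - u j) = false) ?sub0r//.
  exact/eqP/good_neq_opp.
have /good_ratr_independent q0 : \sum_(j < d) ratr (q j) *: u j = 0.
  under eq_bigr do rewrite rmorph_sum scaler_suml.
  rewrite exchange_big /= -[RHS]c0 big_seq [RHS]big_seq.
  apply: eq_bigr => v vD; rewrite -[X in _ = _ *: X](inner v vD) scaler_sumr.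
  apply: eq_bigr => j _; rewrite scalerA rmorphM; congr (_ * _ *: _).
  by rewrite !rmorphB !rmorph_nat.
move=> v vD; have [k vk] := DP v vD.
have := q0 k; rewrite /q (bigD1_seq v) ?fset_uniq//= big_seq_cond big1 ?addr0.
  case: vk => ->; rewrite eqxx.
    rewrite (_ : (u k == - u k) = false) ?subr0 ?mulr1//.
    exact/eqP/good_neq_opp.
  rewrite eq_sym (_ : (u k == - u k) = false); last exact/eqP/good_neq_opp.
  by rewrite sub0r mulrN1 => /eqP; rewrite oppr_eq0 => /eqP.
move=> w /andP[wD wv].
have wNv : w == - v = false by apply: contraNF (DN v vD) => /eqP <-.
suff [-> ->] : (w == u k) = false /\ (w == - u k) = false.
  by rewrite subrr mulr0.
by case: vk wNv (negPf wv) => ->; rewrite ?opprK => -> ->.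
Qed.

(** * The binary set *)

Lemma unit_directions_independent (n : nat) :
  rationally_independent (unit_directions (binary_set n u)).
Proof.
apply: signed_independent => v /imfset2P[/= x xA [y]];
  rewrite !inE => /andP[yA /andP[/eqP xy1 xyArg]] ->.
  case/imfsetP: xA xy1 {xyArg} => a _ ->; case/imfsetP: yA => b _ ->.
  exact: binary_sum_unit_diff.
by rewrite opprB unit_directionsP// -opprB enormN xy1 eqxx upper_ArgN// xyArg.
Qed.

Lemma sum_binary_set (n : nat) (F : plane R -> nat) :
  (\sum_(x <- binary_set n u) F x =
   \sum_(a : {ffun 'I_d -> bool} | \sum_(j < d) a j * 2 ^ j < n)
     F (binary_sum u a))%N.
Proof.
rewrite /binary_set big_imfset /=; last first.
  by move=> a b _ _; exact: binary_sum_inj.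
by rewrite big_filter big_enum_cond.
Qed.

Lemma card_binary_set (n : nat) : (n <= 2 ^ d)%N -> #|` binary_set n u| = n.
Proof.
move=> n_le; rewrite card_fset_sum1 sum_binary_set.
by rewrite (sum_binary (fun=> 1%N) n_le) sum1_card card_ord.
Qed.

(** The code a with its digit j set to 0. *)
Definition clear a j : {ffun 'I_d -> bool} := [ffun i => (i != j) && a i].

Lemma clear_diff a j : a j ->
  binary_sum u a - binary_sum u (clear a j) = u j.
Proof.
move=> aj; rewrite binary_sumB -[RHS]sum_delta_ord; apply: eq_bigr => i _.
by rewrite ffunE; case: eqP => [->|_]; rewrite ?aj ?subr0 ?subrr.
Qed.

Lemma unit_distances_binary_set (n : nat) : (n <= 2 ^ d)%N ->
  (popsum n <= unit_distances (binary_set n u))%N.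
Proof.
move=> n_le; pose D := [fset u j | j : 'I_d].
have uD j : u j \in D by apply: in_imfset.
have oppuD j : - u j \notin D.
  by apply/imfsetP => -[k _ /= /esym]; exact: good_neq_opp.
(* Here a unit distance is oriented by u j rather than by its argument. *)
rewrite (@unit_distances_arcs _ D); first last.
- move=> _ _ /imfsetP[a _ ->] /imfsetP[b _ ->].
  rewrite -[binary_sum u b - _]opprB.
  case/binary_sum_unit_diff => j [] ->; first by rewrite uD (negPf (oppuD j)).
  by rewrite opprK uD (negPf (oppuD j)).
- by move=> x y _ _ /imfsetP[j _ ->]; case: u_good.
rewrite /popsum -(sum_binary popcount n_le) /arcs sum_binary_set.
apply: leq_sum => a a_lt.
rewrite popcount_binary sum_binary_set -!big_mkcondr !sum1dep_card.
rewrite -(card_in_imset (f := clear a)); last first.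
  move=> i j; rewrite !inE /= => ai aj /ffunP/(_ i).
  by rewrite !ffunE eqxx ai andbT; case: eqP.
apply/subset_leq_card/subsetP => b /imsetP[j]; rewrite !inE /= => aj ->.
rewrite clear_diff// uD andbT; apply: leq_ltn_trans a_lt.
by apply: leq_sum => i _; rewrite ffunE leq_mul2r; case: (i != j);
  rewrite ?leqnn ?orbT.
Qed.

End GoodDirections.

Theorem proposition1p2 (R : realType) (n : nat) (n_ge1 : (1 <= n)%N)
  (d : nat) (d_gt : (2 : rat) ^ (d%:Z - 1) < n%:R)
  (d_le : n%:R <= (2 : rat) ^ d%:Z)
  (u : 'I_d -> plane R) (u_good : good u) :
  let A := binary_set n u in
  [/\ #|` A| = n,
      rationally_independent (unit_directions A)
    & unit_distances A = max_unit_distances R n].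
Proof.
have n_le : (n <= 2 ^ d)%N by move: d_le; rewrite -exprnP -natrX ler_nat.
have cardA := card_binary_set u_good n_le.
have D_indep := @unit_directions_independent _ _ _ u_good n.
split=> //; apply/eqP; rewrite eqn_leq; apply/andP; split.
  by have := leq_max_unit_distances D_indep; rewrite cardA.
apply/bigmax_leqP => t /asboolP[B [cardB B_indep <-]].
apply: leq_trans (unit_distances_le_popsum B_indep) _.
by rewrite cardB; exact: unit_distances_binary_set.
Qed.
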